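(* Let $\mathcal P$ and $\mathcal Q$ be properties of filtrations as in the context: $\mathcal P\Rightarrow\mathcal Q$, every $\mathcal Q$-filtration consists of normal subgroups, $\gamma_*(G)$ is a $\mathcal Q$-filtration for every group $G$, every $\mathcal P$-filtration is central, and hypotheses (H0), (H1), (H2), (H3), (H4), (HR0), (HR1), (HR2) hold. Let a group $K$ act on a group $H$ by automorphisms such that the induced action on $\mathrm{gr}_*^{\mathcal P}(H)$ is trivial (that is, $H\rtimes K$ is a $\mathcal P$-almost direct product). Then $H\rtimes K$ is residually $\mathcal R_{\mathcal P}$ if and only if $H$ and $K$ are.
   Context: A filtration $G_*$ on a group $G$ is a sequence of subgroups $G=G_1\supseteq G_2\supseteq\cdots$. It is central if $[G,G_i]\subseteq G_{i+1}$ for all $i\ge1$. Inclusion of filtrations is termwise. For $G_*$ central, $\mathrm{gr}(G_* )=\bigoplus_{i\ge1}G_i/G_{i+1}$. $\gamma_*(G)$ is the lower central series. If a group $K$ acts on a group $H$ by automorphisms and $H_*$ is a filtration on $H$ by normal subgroups, then for $j\ge1$, $\mathcal A_j(K,H_* )$ is the subgroup of all $k\in K$ such that $k$ and $k^{-1}$ map each $H_i$ into itself and $(k\cdot h)h^{-1}\in H_{i+j}$ for all $i\ge1$, $h\in H_i$; $\mathcal A_*(K,H_* )$ is a filtration on the group $\mathcal A_1(K,H_* )$. Write $\mathcal A_*(H_* )=\mathcal A_*(\mathrm{Aut}(H),H_* )$. Given an action of $K=K_1$ on $H=H_1$, a filtration $K_*$ acts on $H_*$ if $K_j\subseteq\mathcal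 A_j(K,H_* )$ for all $j\ge1$; then $H_*\rtimes K_*$ is the filtration of $H\rtimes K$ with terms $H_i\rtimes K_i$. A $\mathcal P$-filtration is a filtration satisfying $\mathcal P$. The hypotheses are: (H0) = (HR0) If $f\colon K\to G$ is a group morphism and $G_*$ is a $\mathcal P$-filtration on $G$, then $f^{-1}(G_* )$ is a $\mathcal P$-filtration on $K$. (H1) If $G_*$ is a $\mathcal P$-filtration, then so is $\mathcal A_*(G_* )$. (H2) If $K_*$ acts on $H_*$ and both $K_*$ and $H_*$ satisfy $\mathcal P$, then so does $H_*\rtimes K_*$. (H3) For every $\mathcal Q$-filtration $G_*$, there is a smallest $\mathcal P$-filtration $G_*^{\mathcal P}$ (on the same group) containing $G_*$. (H4) For every $\mathcal Q$-filtration $G_*$, $\mathcal A_*(G_* )\subseteq\mathcal A_*(G_*^{\mathcal P})$. (HR1) If $G_*$ is a $\mathcal P$-filtration, then for every $n\ge1$, $G_*/G_n$ (the filtration of $G_1/G_n$ by the images of the $G_i$) is a $\mathcal P$-filtration on $G_1/G_n$. (HR2) For every group $G$ there is a smallest $\mathcal P$-filtration $\gamma_*^{\mathcal P}(G)$ with $\gamma_1^{\mathcal P}(G)=G$. Under these assumptions $\gamma_*^{\mathcal P}(G)=\gamma_*(G)^{\mathcal P}$ and its terms are fully invariant in $G$; put $\mathrm{gr}_*^{\mathcal P}(G)=\mathrm{gr}(\gamma_*^{\mathcal P}(G))$, on which $\mathrm{Aut}(G)$ acts. $\mathcal R_{\mathcal P}$ is the class of groups $G$ with $\gamma_n^{\mathcal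 P}(G)=\{1\}$ for some $n\ge1$. A group $G$ is residually $\mathcal R$ (for a class of groups $\mathcal R$) if for every $g\in G\setminus\{1\}$ there is a surjective morphism $\psi\colon G\to Q$ with $Q\in\mathcal R$ and $\psi(g)\neq1$. *)

(* Defs.v *)
From HB Require Import structures.
From mathcomp Require Import all_boot.
From mathcomp Require Import boolp classical_sets.

Set Implicit Arguments.
Unset Strict Implicit.
Unset Printing Implicit Defensive.

Local Open Scope classical_set_scope.
Local Open Scope group_scope.

(* Groups are the (possibly infinite) groups of type [groupType]; group
   morphisms are the library's [{multiplicative G -> H}]. *)

Section GroupMorphisms.
Variables (G H : groupType) (f : {multiplicative G -> H}).

Lemma mulmor1 : f 1 = 1.
Proof. by apply: (@mulgI _ (f 1)); rewrite mulg1 -gmulfM mulg1. Qed.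

Lemma mulmorV x : f x^-1 = (f x)^-1.
Proof. by apply: (@mulgI _ (f x)); rewrite -gmulfM !mulgV mulmor1. Qed.

End GroupMorphisms.

Section Subgroups.
Variable G : groupType.
Implicit Types A B N : set G.

Definition is_subgroup A :=
  [/\ A 1, forall x y, A x -> A y -> A (x * y) & forall x, A x -> A x^-1].

Definition is_normal N := forall x g, N x -> N (x ^ g).

Definition gen A : set G := smallest is_subgroup A.

Lemma gen_subgroup A : is_subgroup (gen A).
Proof.
split=> [B [[]] //|x y Ax Ay B BP|x Ax B BP]; have [[B1 BM BV] AB] := BP.
- by apply: BM; [apply: Ax|apply: Ay].
- by apply: BV; apply: Ax.
Qed.

(* [A, B] *)
Definition commutator A B : set G := gen [set [~ x, y] | x in A & y in B].

Definition lcoset A (x : G) : set G := [set x * a | a in A].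

(* The set A / N of left cosets in A of a subgroup N. *)
Definition cosets A N : set (set G) := [set lcoset N x | x in A].

End Subgroups.

Record subgroup (G : groupType) := Subgroup {
  subgroup_set :> set G;
  subgroupP : is_subgroup subgroup_set
}.

Record normal_subgroup (G : groupType) := NormalSubgroup {
  normal_set :> set G;
  normal_is_subgroup : is_subgroup normal_set;
  normalP : is_normal normal_set
}.

(* A subgroup as a group in its own right. *)
Record subgroup_group (G : groupType) (S : subgroup G) := SubgroupElement {
  sgval : G;
  sgvalP : sgval \in subgroup_set S
}.

Section SubgroupGroup.
Variables (G : groupType) (S : subgroup G).

HB.instance Definition _ := [isSub for @sgval G S].
HB.instance Definition _ := [Choice of subgroup_group S by <:].

Lemma subgroup_group_closed : group_closed (mem (subgroup_set S)).
Proof.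
have [S1 SM SV] := subgroupP S; split; first exact: mem_set.
by move=> x y /set_mem Sx /set_mem Sy; apply: mem_set; apply: SM => //; apply: SV.
Qed.

HB.instance Definition _ :=
  SubChoice_isSubGroup.Build G _ (subgroup_group S) subgroup_group_closed.

End SubgroupGroup.

(* The quotient group G / N: its elements are the cosets of N, multiplied and
   inverted as subsets of G. *)
Record quotient (G : groupType) (N : normal_subgroup G) := QuotientElement {
  qcoset : set G;
  qcosetP : qcoset \in cosets [set: G] N
}.

Section Quotient.
Variables (G : groupType) (N : normal_subgroup G).
Implicit Types C D : quotient N.

HB.instance Definition _ := [isSub for @qcoset G N].
HB.instance Definition _ := [Choice of quotient N by <:].

Lemma mem_cosets x : lcoset N x \in cosets [set: G] N.
Proof. by apply: mem_set; exists x. Qed.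

Definition proj (x : G) : quotient N := QuotientElement (mem_cosets x).

Lemma projP C : exists x, C = proj x.
Proof.
case: C => C CN; have [x _ xC] := set_mem CN.
by exists x; apply: val_inj.
Qed.

Lemma lcosetM x y :
  [set a * b | a in lcoset N x & b in lcoset N y] = lcoset N (x * y).
Proof.
have [N1 NM NV] := normal_is_subgroup N.
rewrite eqEsubset; split=> z.
- move=> [_ [a Na <-]] [_ [b Nb <-]] <-; exists (a ^ y * b).
    by apply: NM => //; apply: normalP.
  by rewrite /conjg !mulgA mulgK.
- move=> [a Na <-]; exists x; first by exists 1; rewrite ?mulg1.
  by exists (y * a); [exists a|rewrite mulgA].
Qed.

Lemma lcosetV x : [set a^-1 | a in lcoset N x] = lcoset N x^-1.
Proof.
have [N1 NM NV] := normal_is_subgroup N.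
rewrite eqEsubset; split=> z.
- move=> [_ [a Na <-]] <-; exists (a^-1 ^ x^-1).
    by apply: normalP; apply: NV.
  by rewrite /conjg invgK invgM !mulgA mulVg mul1g.
- move=> [a Na <-]; exists (x * a^-1 ^ x); last first.
    by rewrite /conjg !mulgA mulgV mul1g invgM invgK.
  by exists (a^-1 ^ x) => //; apply: normalP; apply: NV.
Qed.

Fact quotient_mul_subproof C D :
  [set a * b | a in qcoset C & b in qcoset D] \in cosets [set: G] N.
Proof.
have [[x ->] [y ->]] := (projP C, projP D).
by rewrite /= lcosetM mem_cosets.
Qed.

Fact quotient_inv_subproof C : [set a^-1 | a in qcoset C] \in cosets [set: G] N.
Proof. by have [x ->] := projP C; rewrite /= lcosetV mem_cosets. Qed.

Definition quotient_mul C D : quotient N := QuotientElement (quotient_mul_subproof C D).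
Definition quotient_inv C : quotient N := QuotientElement (quotient_inv_subproof C).
Definition quotient_one : quotient N := proj 1.

Lemma quotient_mulE x y : quotient_mul (proj x) (proj y) = proj (x * y).
Proof. by apply: val_inj; rewrite /= lcosetM. Qed.

Lemma quotient_invE x : quotient_inv (proj x) = proj x^-1.
Proof. by apply: val_inj; rewrite /= lcosetV. Qed.

Fact quotient_mulA : associative quotient_mul.
Proof.
move=> A B C; have [[[x ->] [y ->]] [z ->]] := (projP A, projP B, projP C).
by rewrite !quotient_mulE mulgA.
Qed.

Fact quotient_mul1 : left_id quotient_one quotient_mul.
Proof. by move=> C; have [x ->] := projP C; rewrite quotient_mulE mul1g. Qed.

Fact quotient_1mul : right_id quotient_one quotient_mul.
Proof. by move=> C; have [x ->] := projP C; rewrite quotient_mulE mulg1. Qed.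

Fact quotient_mulV : left_inverse quotient_one quotient_inv quotient_mul.
Proof.
by move=> C; have [x ->] := projP C; rewrite quotient_invE quotient_mulE mulVg.
Qed.

Fact quotient_Vmul : right_inverse quotient_one quotient_inv quotient_mul.
Proof.
by move=> C; have [x ->] := projP C; rewrite quotient_invE quotient_mulE mulgV.
Qed.

HB.instance Definition _ := isGroup.Build (quotient N)
  quotient_mulA quotient_mul1 quotient_1mul quotient_mulV quotient_Vmul.

Fact proj_gmulfM : {morph proj : x y / x * y}.
Proof. by move=> x y; rewrite -quotient_mulE. Qed.

HB.instance Definition _ := isMultiplicative.Build G (quotient N) proj proj_gmulfM.

End Quotient.

(* The automorphism group of G, with composition as its product. *)
Record aut (G : groupType) := Aut {
  aut_fun :> G -> G;
  aut_inv : G -> G;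
  aut_morph : {morph aut_fun : x y / x * y};
  aut_funK : cancel aut_fun aut_inv;
  aut_invK : cancel aut_inv aut_fun
}.

Section AutGroup.
Variable G : groupType.
Implicit Types a b : aut G.

Lemma aut_ext a b : a =1 b -> a = b.
Proof.
move=> ab.
case: a b ab => [f f' fM fK f'K] [g g' gM gK g'K] /= /funext fg; subst g.
have f'g' : f' = g' by apply: funext => x; apply: (can_inj fK); rewrite f'K g'K.
by subst g'; congr Aut; apply: Prop_irrelevance.
Qed.

HB.instance Definition _ := gen_eqMixin (aut G).
HB.instance Definition _ := gen_choiceMixin (aut G).

Definition aut_one : aut G := @Aut G id id
  (fun _ _ => erefl) (fun _ => erefl) (fun _ => erefl).

Definition aut_mul a b : aut G.
Proof.
apply: (@Aut G (a \o b) (aut_inv b \o aut_inv a)) => [x y|x|x] /=.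
- by rewrite !aut_morph.
- by rewrite !aut_funK.
- by rewrite !aut_invK.
Defined.

Definition aut_opp a : aut G.
Proof.
apply: (@Aut G (aut_inv a) a _ (@aut_invK _ a) (@aut_funK _ a)) => x y.
by apply: (can_inj (@aut_funK _ a)); rewrite aut_morph !aut_invK.
Defined.

Fact aut_mulA : associative aut_mul.
Proof. by move=> a b c; apply: aut_ext. Qed.

Fact aut_mul1 : left_id aut_one aut_mul.
Proof. by move=> a; apply: aut_ext. Qed.

Fact aut_1mul : right_id aut_one aut_mul.
Proof. by move=> a; apply: aut_ext. Qed.

Fact aut_mulV : left_inverse aut_one aut_opp aut_mul.
Proof. by move=> a; apply: aut_ext => x /=; rewrite aut_funK. Qed.

Fact aut_Vmul : right_inverse aut_one aut_opp aut_mul.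
Proof. by move=> a; apply: aut_ext => x /=; rewrite aut_invK. Qed.

HB.instance Definition _ := isGroup.Build (aut G)
  aut_mulA aut_mul1 aut_1mul aut_mulV aut_Vmul.

HB.instance Definition _ a := isMultiplicative.Build G G a (@aut_morph _ a).

End AutGroup.

(* An action of K on H by automorphisms is a morphism phi : K -> Aut(H);
   [phi k h] is the element k . h of H. *)

Record sdprod (H K : groupType) (phi : {multiplicative K -> aut H}) :=
  Sdprod { sdl : H; sdr : K }.

Section SemidirectProduct.
Variables (H K : groupType) (phi : {multiplicative K -> aut H}).
Implicit Types x y z : sdprod phi.

HB.instance Definition _ := gen_eqMixin (sdprod phi).
HB.instance Definition _ := gen_choiceMixin (sdprod phi).

Definition sdprod_one : sdprod phi := Sdprod phi 1 1.
Definition sdprod_mul x y : sdprod phi :=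
  Sdprod phi (sdl x * phi (sdr x) (sdl y)) (sdr x * sdr y).
Definition sdprod_inv x : sdprod phi :=
  Sdprod phi (phi (sdr x)^-1 (sdl x)^-1) (sdr x)^-1.

Fact sdprod_mulA : associative sdprod_mul.
Proof.
by move=> [h k] [h' k'] [h'' k'']; rewrite /sdprod_mul /= !gmulfM /= !mulgA.
Qed.

Fact sdprod_mul1 : left_id sdprod_one sdprod_mul.
Proof. by case=> h k; rewrite /sdprod_mul /= mulmor1 !mul1g. Qed.

Fact sdprod_1mul : right_id sdprod_one sdprod_mul.
Proof. by case=> h k; rewrite /sdprod_mul /= mulmor1 !mulg1. Qed.

Fact sdprod_mulV : left_inverse sdprod_one sdprod_inv sdprod_mul.
Proof.
by case=> h k; rewrite /sdprod_mul /= -gmulfM !mulVg mulmor1.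
Qed.

Fact sdprod_Vmul : right_inverse sdprod_one sdprod_inv sdprod_mul.
Proof.
case=> h k; rewrite /sdprod_mul /= mulgV; congr Sdprod.
by rewrite (mulmorV phi) /= aut_invK mulgV.
Qed.

HB.instance Definition _ := isGroup.Build (sdprod phi)
  sdprod_mulA sdprod_mul1 sdprod_1mul sdprod_mulV sdprod_Vmul.

End SemidirectProduct.

(* A filtration G = G_1 >= G_2 >= ... on G. Terms are indexed by nat; the
   extra term of index 0 carries no information, since the axioms force it to
   be equal to G. *)
Record filtration (G : groupType) := Filtration {
  fterm :> nat -> set G;
  fterm1 : fterm 1%N = [set: G];
  fterm_subgroup : forall i, is_subgroup (fterm i);
  fterm_decr : forall i, fterm i.+1 `<=` fterm i
}.

HB.instance Definition _ (G : groupType) := gen_eqMixin (filtration G).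
HB.instance Definition _ (G : groupType) := gen_choiceMixin (filtration G).

Lemma ftermT (G : groupType) (F : filtration G) i :
  (i <= 1)%N -> F i = [set: G].
Proof.
case: i => [|[]] // _; last exact: fterm1.
by rewrite eqEsubset; split=> // x _; apply: fterm_decr; rewrite fterm1.
Qed.

Definition filtration_le (G : groupType) (E F : filtration G) :=
  forall i, (1 <= i)%N -> E i `<=` F i.

Definition central (G : groupType) (F : filtration G) :=
  forall i, (1 <= i)%N -> commutator [set: G] (F i) `<=` F i.+1.

Section LowerCentralSeries.
Variable G : groupType.

(* gamma_0 = gamma_1 = G and gamma_{i+1} = [G, gamma_i] for i >= 1 *)
Fixpoint lcs_term (i : nat) : set G :=
  if i is (j.+1 as k).+1 then commutator [set: G] (lcs_term k) else [set: G].

Lemma setT_subgroup : is_subgroup [set: G].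
Proof. by []. Qed.

Fact lcs_subgroup i : is_subgroup (lcs_term i).
Proof. by case: i => [|[|i]] //=; apply: gen_subgroup. Qed.

Lemma commutator_normal (A : set G) : is_normal A -> is_normal (commutator [set: G] A).
Proof.
move=> nA x g Ax B BP.
have [[B1 BM BV] AB] := BP.
apply: (Ax [set y | B (y ^ g)]); split.
  split=> /= [|y z|y]; first by rewrite conj1g.
    by rewrite conjMg; apply: BM.
  by rewrite conjVg; apply: BV.
move=> _ [y _] [z Az] <-; apply: AB.
by exists (y ^ g) => //; exists (z ^ g); [apply: nA|rewrite conjRg].
Qed.

Lemma lcs_normal i : is_normal (lcs_term i).
Proof. by elim: i => [|[|i]] // IH; apply: commutator_normal. Qed.

Fact lcs_decr i : lcs_term i.+1 `<=` lcs_term i.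
Proof.
case: i => [|i] //= x; apply; split; first exact: (lcs_subgroup i.+1).
have [_ M V] := lcs_subgroup i.+1.
move=> _ [y _] [z Az] <-.
rewrite /commg /conjg !mulgA; apply: (M _ z) => //.
by have := lcs_normal y (V _ Az); rewrite /conjg mulgA.
Qed.

Definition lcs : filtration G := Filtration erefl lcs_subgroup lcs_decr.

End LowerCentralSeries.

(* f^{-1}(F) *)
Section Preimage.
Variables (K G : groupType) (f : {multiplicative K -> G}) (F : filtration G).

Fact preimage_fterm1 : f @^-1` F 1%N = [set: K].
Proof. by rewrite fterm1. Qed.

Fact preimage_subgroup i : is_subgroup (f @^-1` F i).
Proof.
have [F1 FM FV] := fterm_subgroup F i; split=> [|x y|x] /=.
- by rewrite mulmor1.
- by rewrite gmulfM; apply: FM.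
- by rewrite mulmorV; apply: FV.
Qed.

Fact preimage_decr i : f @^-1` F i.+1 `<=` f @^-1` F i.
Proof. by move=> x /=; apply: fterm_decr. Qed.

Definition preimage_filtration : filtration K :=
  Filtration preimage_fterm1 preimage_subgroup preimage_decr.

End Preimage.

(* The filtration of G / N by the images of the terms of F *)
Section QuotientFiltration.
Variables (G : groupType) (F : filtration G) (N : normal_subgroup G).

Fact quotient_fterm1 : @proj G N @` F 1%N = [set: quotient N].
Proof.
rewrite fterm1 eqEsubset; split=> // C _.
by have [x ->] := projP C; exists x.
Qed.

Fact quotient_subgroup i : is_subgroup (@proj G N @` F i).
Proof.
have [F1 FM FV] := fterm_subgroup F i; split=> [|_ _ [x Fx <-] [y Fy <-]|_ [x Fx <-]].
- by exists 1 => //; rewrite mulmor1.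
- by exists (x * y); [apply: FM|rewrite gmulfM].
- by exists x^-1; [apply: FV|rewrite mulmorV].
Qed.

Fact quotient_decr i : @proj G N @` F i.+1 `<=` @proj G N @` F i.
Proof. by move=> _ [x Fx <-]; exists x => //; apply: fterm_decr. Qed.

Definition quotient_filtration : filtration (quotient N) :=
  Filtration quotient_fterm1 quotient_subgroup quotient_decr.

End QuotientFiltration.

(* [Aterm j] is the subgroup A_j(K, F) of K; [Afiltration] is the filtration
   they form on the group A_1(K, F). *)
Section ActionFiltration.
Variables (H K : groupType) (phi : {multiplicative K -> aut H}).
Variable F : filtration H.

Definition Aterm (j : nat) : set K :=
  [set k | forall i, (1 <= i)%N -> forall h, F i h ->
     [/\ F i (phi k h), F i (phi k^-1 h) & F (i + j)%N (phi k h * h^-1)]].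

Fact Aterm_subgroup j : is_subgroup (Aterm j).
Proof.
split=> [i _ h Fh|k l Ak Al i i1 h Fh|k Ak i i1 h Fh].
- have [F1 _ _] := fterm_subgroup F (i + j).
  by rewrite invg1 mulmor1 /= mulgV.
- have [_ FM _] := fterm_subgroup F (i + j).
  have ij1 : (1 <= i + j)%N by rewrite (leq_trans i1) ?leq_addr.
  have [Fl FVl Dl] := Al i i1 h Fh; have [Fk FVk Dk] := Ak i i1 h Fh.
  rewrite invgM !gmulfM /=; split.
  + by have [] := Ak i i1 _ Fl.
  + by have [] := Al i i1 _ FVk.
  + have -> : phi k (phi l h) * h^-1
        = phi k (phi l h * h^-1) * (phi k h * h^-1).
      by rewrite gmulfM mulmorV mulgA mulgVK.
    by apply: FM => //; have [] := Ak _ ij1 _ Dl.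
- have [_ _ FV] := fterm_subgroup F (i + j).
  have ij1 : (1 <= i + j)%N by rewrite (leq_trans i1) ?leq_addr.
  have [Fk FVk Dk] := Ak i i1 h Fh.
  rewrite invgK; split=> //.
  have -> : phi k^-1 h * h^-1 = phi k^-1 (phi k h * h^-1)^-1.
    by rewrite invgM invgK gmulfM (mulmorV (phi k^-1)) (mulmorV phi) /= aut_funK.
  by have [] := Ak _ ij1 _ (FV _ Dk).
Qed.

Definition Agroup : subgroup K := Subgroup (Aterm_subgroup 1).

Fact Aterm_decr j : Aterm j.+1 `<=` Aterm j.
Proof.
move=> k Ak i i1 h Fh; have [Fk FVk Dk] := Ak i i1 h Fh.
by split=> //; apply: fterm_decr; rewrite -addnS.
Qed.

Definition Afterm (j : nat) : set (subgroup_group Agroup) :=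
  [set k | Aterm j (sgval k)].

Fact Afterm1 : Afterm 1 = [set: subgroup_group Agroup].
Proof.
by rewrite eqEsubset; split=> // k _; apply: (set_mem (sgvalP k)).
Qed.

Fact Afterm_subgroup j : is_subgroup (Afterm j).
Proof.
have [A1 AM AV] := Aterm_subgroup j; split=> [//|x y Ax Ay|x Ax].
- exact: AM.
- exact: AV.
Qed.

Fact Afterm_decr j : Afterm j.+1 `<=` Afterm j.
Proof. by move=> k; apply: Aterm_decr. Qed.

Definition Afiltration : filtration (subgroup_group Agroup) :=
  Filtration Afterm1 Afterm_subgroup Afterm_decr.

Definition filtration_acts (E : filtration K) :=
  forall j, (1 <= j)%N -> E j `<=` Aterm j.

End ActionFiltration.

(* A_j(F) = A_j(Aut(H), F), for the tautological action of Aut(H) on H. *)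
Definition aut_action (H : groupType) : {multiplicative aut H -> aut H} := idfun.
Definition AutAterm (H : groupType) (F : filtration H) : nat -> set (aut H) :=
  Aterm (aut_action H) F.
Definition AutAfiltration (H : groupType) (F : filtration H) :
    filtration (subgroup_group (Agroup (aut_action H) F)) :=
  Afiltration (aut_action H) F.

(* The terms are F_i x| E_i. *)
Section SdprodFiltration.
Variables (H K : groupType) (phi : {multiplicative K -> aut H}).
Variables (F : filtration H) (E : filtration K).
Hypothesis actEF : filtration_acts phi F E.

Definition sdprod_fterm (i : nat) : set (sdprod phi) :=
  [set x | F i (sdl x) /\ E i (sdr x)].

Fact sdprod_fterm1 : sdprod_fterm 1 = [set: sdprod phi].
Proof. by rewrite eqEsubset; split=> // x _; split; rewrite fterm1. Qed.

Lemma filtration_acts_stable i k h : F i h -> F i (phi k h).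
Proof.
case: i => [|i] Fh; first by rewrite ftermT.
have E1k : E 1%N k by rewrite fterm1.
by have [] := actEF (leqnn 1) E1k (ltn0Sn i) Fh.
Qed.

Fact sdprod_subgroup i : is_subgroup (sdprod_fterm i).
Proof.
have [[F1 FM FV] [E1 EM EV]] := (fterm_subgroup F i, fterm_subgroup E i).
split=> [|x y [Fx Ex] [Fy Ey]|x [Fx Ex]]; split=> //=.
- by apply: FM => //; apply: filtration_acts_stable.
- exact: EM.
- by apply: filtration_acts_stable; apply: FV.
- exact: EV.
Qed.

Fact sdprod_decr i : sdprod_fterm i.+1 `<=` sdprod_fterm i.
Proof. by move=> x [Fx Ex]; split; apply: fterm_decr. Qed.

Definition sdprod_filtration : filtration (sdprod phi) :=
  Filtration sdprod_fterm1 sdprod_subgroup sdprod_decr.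

End SdprodFiltration.

(* The underlying set of gr(F), the direct sum of the F_i / F_{i+1}: families
   (c_i) of cosets, almost all of which are trivial. The summand of index 0
   is F_0 / F_1 = G / G, so it contributes nothing. *)
Definition gr (G : groupType) (F : filtration G) : set (nat -> set G) :=
  [set c | (forall i, cosets (F i) (F i.+1) (c i)) /\
           (exists n, forall i, (n <= i)%N -> c i = F i.+1)].

(* The action of an automorphism on gr(F) induced by its action on cosets,
   for a filtration F whose terms are stable under it. *)
Definition gr_act (G : groupType) (a : aut G) (c : nat -> set G) : nat -> set G :=
  fun i => a @` c i.

Definition gr_action_trivial (H K : groupType) (phi : {multiplicative K -> aut H})
    (F : filtration H) :=
  forall k c, gr F c -> gr_act (phi k) c = c.

Definition filtration_property := forall G : groupType, filtration G -> Prop.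

Definition is_smallest_filtration (G : groupType) (S : set (filtration G))
    (F : filtration G) :=
  S F /\ forall E, S E -> filtration_le F E.

(* The smallest element of S, or F0 if there is none. *)
Definition smallest_filtration (G : groupType) (F0 : filtration G)
    (S : set (filtration G)) : filtration G :=
  xget F0 (is_smallest_filtration S).

Section Properties.
Variable P : filtration_property.

Definition containing (G : groupType) (F : filtration G) : set (filtration G) :=
  [set E | @P G E /\ filtration_le F E].

(* F^P; meaningful when [containing F] has a smallest element. *)
Definition Pclosure (G : groupType) (F : filtration G) : filtration G :=
  smallest_filtration F (containing F).

(* gamma^P(G); meaningful when there is a smallest P-filtration on G. *)
Definition gammaP (G : groupType) : filtration G :=
  smallest_filtration (lcs G) [set E | @P G E].

Definition RP (G : groupType) : Prop :=
  exists n, (1 <= n)%N /\ gammaP G n = [set 1].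

End Properties.

Definition residually (R : groupType -> Prop) (G : groupType) : Prop :=
  forall g : G, g <> 1 ->
    exists (Q : groupType) (psi : {multiplicative G -> Q}),
      [/\ R Q, range psi = [set: Q] & psi g <> 1].

(* Main.v *)
Require Import Defs.
From HB Require Import structures.
From mathcomp Require Import all_boot.
From mathcomp Require Import boolp classical_sets.

(** The lower P-central series [gammaP P G] is functorial: since P-filtrations
    pull back along morphisms, minimality forces every morphism to respect these
    series. Together with the fact that [G / gammaP P G n] carries a
    P-filtration vanishing at rank [n], this shows that [G] is residually
    [RP P] exactly when the terms of [gammaP P G] intersect trivially
    ([residually_RPP]).

    It thus suffices to prove that the series of the semidirect product is, term
    by term, the semidirect product of the series of [H] and [K]
    ([gammaP_sdprod]). Functoriality along the inclusions of [H] and [K] gives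
    one inclusion. For the other, minimality reduces the claim to [gammaP P H]
    x| [gammaP P K] being a P-filtration, which holds as soon as the second
    filtration acts on the first. Triviality of the action on the graded group
    says only that [K] as a whole lies in rank one of the action filtration,
    i.e. that [phi] lands in the group [A_1] of automorphisms acting trivially
    on it. That group is itself P-filtered by the [A_j], and functoriality along
    [K -> A_1] sends the [j]-th term of [gammaP P K] into [A_j]
    ([gammaP_acts]). *)

Set Implicit Arguments.
Unset Strict Implicit.
Unset Printing Implicit Defensive.

Local Open Scope classical_set_scope.
Local Open Scope group_scope.

(** * Morphisms attached to subgroups and semidirect products *)

Lemma corestrict (K G : groupType) (f : {multiplicative K -> G})
    (S : subgroup G) : (forall k, subgroup_set S (f k)) ->
  exists g : {multiplicative K -> subgroup_group S}, forall k, sgval (g k) = f k.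
Proof.
move=> Sf; pose g k : subgroup_group S := SubgroupElement (mem_set (Sf k)).
have gM : {morph g : x y / x * y}.
  by move=> x y; apply: val_inj; rewrite gmulfM /= gmulfM.
pose g_mixin := isMultiplicative.Build K (subgroup_group S) g gM.
by exists (HB.pack_for {multiplicative K -> subgroup_group S} g g_mixin).
Qed.

Section SdprodInclusions.
Variables (H K : groupType) (phi : {multiplicative K -> aut H}).

Definition sdprod_inl (h : H) : sdprod phi := Sdprod phi h 1.
Definition sdprod_inr (k : K) : sdprod phi := Sdprod phi 1 k.

Fact sdprod_inlM : {morph sdprod_inl : x y / x * y}.
Proof.
move=> x y; rewrite /sdprod_inl -[RHS]/(sdprod_mul _ _) /sdprod_mul /=.
by rewrite mulmor1 mulg1.
Qed.

Fact sdprod_inrM : {morph sdprod_inr : x y / x * y}.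
Proof.
move=> x y; rewrite /sdprod_inr -[RHS]/(sdprod_mul _ _) /sdprod_mul /=.
by rewrite mulmor1 mulg1.
Qed.

HB.instance Definition _ := isMultiplicative.Build H _ sdprod_inl sdprod_inlM.
HB.instance Definition _ := isMultiplicative.Build K _ sdprod_inr sdprod_inrM.

Lemma sdprod_factor (x : sdprod phi) :
  x = sdprod_inl (sdl x) * sdprod_inr (sdr x).
Proof.
case: x => h k; rewrite -[RHS]/(sdprod_mul _ _) /sdprod_mul /=.
by rewrite mulmor1 mulg1 mul1g.
Qed.

End SdprodInclusions.

(** * Trivial actions on the graded group *)

Lemma lcoset1 (G : groupType) (N : set G) : lcoset N 1 = N.
Proof.
rewrite eqEsubset; split=> x; first by case=> a Na <-; rewrite mul1g.
by move=> Nx; exists x => //; rewrite mul1g.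
Qed.

(** Testing the action on the homogeneous element of [gr F] given by the class
    of [h] alone shows that [k] fixes the coset [h F_{i+1}]; normality moves the
    resulting error term from the right of [h] to its left. *)
Lemma gr_action_trivialP (H K : groupType) (phi : {multiplicative K -> aut H})
    (F : filtration H) :
  (forall i, (1 <= i)%N -> is_normal (F i)) ->
  gr_action_trivial phi F -> forall k, Aterm phi F 1 k.
Proof.
move=> nF trF.
have shift k i h : F i h -> F i.+1 (phi k h * h^-1).
  move=> Fh.
  pose c j := if j == i then lcoset (F i.+1) h else F j.+1.
  have grc : gr F c.
    split=> [j|].
      rewrite /c; case: eqP => [->|_]; first by exists h.
      by exists 1; rewrite ?lcoset1 //; have [] := fterm_subgroup F j.
    by exists i.+1 => j ltij; rewrite /c gtn_eqF.
  have ci : c i = lcoset (F i.+1) h by rewrite /c eqxx.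
  have [F1 _ _] := fterm_subgroup F i.+1.
  have : c i (phi k h).
    rewrite -(trF k c grc); exists h => //; rewrite ci.
    by exists 1 => //; rewrite mulg1.
  rewrite ci => -[a Fa <-].
  by have := nF i.+1 (ltn0Sn i) a h^-1 Fa; rewrite /conjg invgK mulgA.
have stable k i h : F i h -> F i (phi k h).
  move=> Fh; have [_ FM _] := fterm_subgroup F i.
  rewrite -(mulgVK h (phi k h)); apply: FM => //.
  by apply/fterm_decr/shift.
move=> k i _ h Fh; split; [exact: stable|exact: stable|].
by rewrite addn1; apply: shift.
Qed.

(** * Lower P-central series *)

Definition preimage_closed (P : filtration_property) :=
  forall (K G : groupType) (f : {multiplicative K -> G}) (F : filtration G),
    P G F -> P K (preimage_filtration f F).

Definition has_gammaP (P : filtration_property) :=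
  forall G : groupType, exists F, is_smallest_filtration [set E | P G E] F.

Lemma gammaP_smallest (P : filtration_property) (G : groupType) :
  has_gammaP P -> is_smallest_filtration [set E | P G E] (gammaP P G).
Proof. by move=> exP; apply: xgetPex; apply: exP. Qed.

Lemma gammaP_functorial (P : filtration_property) (K G : groupType)
    (f : {multiplicative K -> G}) :
  preimage_closed P -> has_gammaP P ->
  forall n, (1 <= n)%N -> forall x, gammaP P K n x -> gammaP P G n (f x).
Proof.
move=> preP exP n n1 x.
have [PG _] := gammaP_smallest G exP; have [_ minK] := gammaP_smallest K exP.
exact: (minK _ (preP _ _ f _ PG) n n1 x).
Qed.

(** Any quotient in [RP P] kills some term of the series by functoriality;
    conversely, an element outside the [n]-th term survives in the quotient by
    that term, on which the image filtration is a P-filtration with trivial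
    [n]-th term and hence bounds the series of the quotient. *)
Lemma residually_RPP (P : filtration_property) (G : groupType) :
  preimage_closed P -> has_gammaP P ->
  (forall n, (1 <= n)%N -> is_normal (gammaP P G n)) ->
  (forall n, (1 <= n)%N -> forall N : normal_subgroup G,
     N = gammaP P G n :> set G -> P _ (quotient_filtration (gammaP P G) N)) ->
  residually (RP P) G <->
  (forall g, (forall n, (1 <= n)%N -> gammaP P G n g) -> g = 1).
Proof.
move=> preP exP nG quoP; split=> [resG g gG|sepG g g_neq1].
  apply: contrapT => /resG[Q [psi [[n [n1 Qn]] _]]]; apply.
  have := gammaP_functorial psi preP exP n1 (gG n n1).
  by rewrite Qn.
have [n [n1 gNn]] : exists n, (1 <= n)%N /\ ~ gammaP P G n g.
  apply: contrapT => noN; apply/g_neq1/sepG => n n1.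
  by apply: contrapT => gNn; apply: noN; exists n.
pose N := NormalSubgroup (fterm_subgroup (gammaP P G) n) (nG n n1).
exists (quotient N), (@proj G N); split.
- exists n; split=> //; rewrite eqEsubset; split=> [C|_ ->]; last first.
    by have [] := fterm_subgroup (gammaP P (quotient N)) n.
  have [_ minQ] := gammaP_smallest (quotient N) exP.
  move=> /(minQ _ (quoP n n1 N erefl) n n1)[x Nx <-].
  apply: val_inj; rewrite /= lcoset1 eqEsubset.
  have [N1 NM NV] := normal_is_subgroup N; split=> y.
    by case=> a Na <-; apply: NM.
  move=> Ny; exists (x^-1 * y); last by rewrite mulgA mulgV mul1g.
  by apply: NM => //; apply: NV.
- rewrite eqEsubset; split=> // C _.
  by have [x ->] := projP C; exists x.
- move=> /(congr1 (@qcoset _ _)) /= gN; apply: gNn.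
  have : lcoset N g g.
    by exists 1; rewrite ?mulg1 //; have [] := normal_is_subgroup N.
  by rewrite gN lcoset1.
Qed.

(** * Almost direct products *)

(** The hypothesis only concerns rank one; the higher ranks come for free,
    because the action filtration satisfies P and [phi] corestricts to a
    morphism into the group that it filters. *)
Lemma gammaP_acts (P : filtration_property) (H K : groupType)
    (phi : {multiplicative K -> aut H}) (F : filtration H) :
  preimage_closed P -> has_gammaP P -> P _ (AutAfiltration F) ->
  (forall k, Aterm phi F 1 k) -> filtration_acts phi F (gammaP P K).
Proof.
move=> preP exP PA A1.
have [|g gE] := @corestrict _ _ phi (Agroup (aut_action H) F).
  by move=> k i i1 h Fh; have := A1 k i i1 h Fh; rewrite mulmorV.
have [_ minK] := gammaP_smallest K exP.
move=> j j1 k /(minK _ (preP _ _ g _ PA) j j1).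
rewrite /= /Afterm /= gE => Ak i i1 h Fh.
by rewrite mulmorV; apply: Ak.
Qed.

Lemma gammaP_sdprod (P : filtration_property) (H K : groupType)
    (phi : {multiplicative K -> aut H})
    (act : filtration_acts phi (gammaP P H) (gammaP P K)) :
  preimage_closed P -> has_gammaP P -> P _ (sdprod_filtration act) ->
  forall n, (1 <= n)%N ->
    gammaP P (sdprod phi) n = @sdprod_fterm H K phi (gammaP P H) (gammaP P K) n.
Proof.
move=> preP exP PHK n n1; rewrite eqEsubset; split=> x.
  by have [_ minHK] := gammaP_smallest (sdprod phi) exP; apply: (minHK _ PHK).
have [_ gM _] := fterm_subgroup (gammaP P (sdprod phi)) n.
case=> Hx Kx; rewrite (sdprod_factor x); apply: gM.
- exact: (gammaP_functorial (@sdprod_inl _ _ phi) preP exP).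
- exact: (gammaP_functorial (@sdprod_inr _ _ phi) preP exP).
Qed.

Theorem theorem7p13
  (P Q : filtration_property)
  (PQ : forall (G : groupType) (F : filtration G), P G F -> Q G F)
  (Qnormal : forall (G : groupType) (F : filtration G), Q G F ->
    forall i, (1 <= i)%N -> is_normal (F i))
  (Qlcs : forall G : groupType, Q G (lcs G))
  (Pcentral : forall (G : groupType) (F : filtration G), P G F -> central F)
  (H0 : forall (K G : groupType) (f : {multiplicative K -> G}) (F : filtration G),
    P G F -> P K (preimage_filtration f F))
  (H1 : forall (G : groupType) (F : filtration G),
    P G F -> P _ (AutAfiltration F))
  (H2 : forall (H K : groupType) (phi : {multiplicative K -> aut H})
    (F : filtration H) (E : filtration K) (actEF : filtration_acts phi F E),
    P K E -> P H F -> P _ (sdprod_filtration actEF))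
  (H3 : forall (G : groupType) (F : filtration G), Q G F ->
    exists FP, is_smallest_filtration (containing P F) FP)
  (H4 : forall (G : groupType) (F : filtration G), Q G F ->
    forall j, (1 <= j)%N -> AutAterm F j `<=` AutAterm (Pclosure P F) j)
  (HR1 : forall (G : groupType) (F : filtration G), P G F ->
    forall n, (1 <= n)%N -> forall N : normal_subgroup G, N = F n :> set G ->
      P _ (quotient_filtration F N))
  (HR2 : forall G : groupType, exists F, is_smallest_filtration [set E | P G E] F)
  (H K : groupType) (phi : {multiplicative K -> aut H})
  (trivial_action : gr_action_trivial phi (gammaP P H)) :
  residually (RP P) (sdprod phi) <->
  residually (RP P) H /\ residually (RP P) K.
Proof.
have PgammaP G : P G (gammaP P G) by have [] := gammaP_smallest G HR2.
have ngammaP G n : (1 <= n)%N -> is_normal (gammaP P G n).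
  by apply: Qnormal; apply: PQ.
have resE G := residually_RPP H0 HR2 (@ngammaP G) (HR1 _ _ (PgammaP G)).
have A1 := gr_action_trivialP (@ngammaP H) trivial_action.
have act := gammaP_acts H0 HR2 (H1 _ _ (PgammaP H)) A1.
have gE := gammaP_sdprod H0 HR2
  (H2 _ _ _ _ _ act (PgammaP K) (PgammaP H)).
rewrite !resE; split=> [sepHK|[sepH sepK] [h k] ghk].
  split=> [h gh|k gk].
  - have /(congr1 (@sdl _ _ _)) // : Sdprod phi h 1 = 1.
    apply: sepHK => n n1; rewrite gE //; split; first exact: gh.
    by have [] := fterm_subgroup (gammaP P K) n.
  - have /(congr1 (@sdr _ _ _)) // : Sdprod phi 1 k = 1.
    apply: sepHK => n n1; rewrite gE //; split; last exact: gk.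
    by have [] := fterm_subgroup (gammaP P H) n.
have -> : h = 1 by apply: sepH => n n1; have := ghk n n1; rewrite gE // => -[].
by have -> : k = 1 by apply: sepK => n n1; have := ghk n n1; rewrite gE // => -[].
Qed.
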